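(* Let $G$ and $H$ be two rooted graphs. Then $$U^r(G\odot H)=\frac{1}{z}\,U^r(G)\,U^r(H).$$
   Context: Graphs are finite, with loops and parallel edges allowed. A rooted graph is a pair $(G,v_0)$ with $G=(V,E)$ a graph and $v_0\in V$ its root. For rooted graphs $(G,v)$ and $(H,v')$, the joining $G\odot H$ is the rooted graph obtained from the disjoint union of $G$ and $H$ by identifying $v$ and $v'$, with the identified vertex as root. Let $y,z,x_1,x_2,\dots$ be commuting indeterminates; for a partition $\lambda=(\lambda_1,\dots,\lambda_s)$ put $\mathbf{x}_\lambda=x_{\lambda_1}\cdots x_{\lambda_s}$ ($=1$ for the empty partition). For $A\subseteq E$, $G|_A$ is the spanning subgraph with edge set $A$ (all vertices kept), $k(G|_A)$ is its number of connected components, and $r(A)=|V|-k(G|_A)$. Let $\lambda_r(A)$ be the number of vertices of the component of $G|_A$ containing the root, and $\lambda_-(A)$ the partition formed by the numbers of vertices of all other components. The rooted $U$-polynomial is $$U^r(G)=U^r(G,v_0;\mathbf{x},y,z)=\sum_{A\subseteq E}\mathbf{x}_{\lambda_-(A)}z^{\lambda_r(A)}(y-1)^{|A|-r(A)}.$$ *)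

(* Defs.v *)
From HB Require Import structures.
From mathcomp Require Import all_boot all_order all_algebra finmap.
From mathcomp Require Import generic_quotient fraction.
From mathcomp.multinomials Require Import monalg.

Set Implicit Arguments.
Unset Strict Implicit.
Unset Printing Implicit Defensive.

Import GRing.Theory.
Local Open Scope ring_scope.
Local Open Scope quotient_scope.

(* Polynomials over an integral domain in countably many commuting            *)
(* indeterminates form an integral domain; this is what gives a meaning to    *)
(* 1/z, in the field of fractions. The proof is by Kronecker substitution     *)
(* X_i |-> X^(B^i), which is injective on polynomials of degree < B in each   *)
(* indeterminate.                                                             *)
Section Kronecker.
Context (I : countType) (R : idomainType) (B : nat).

Implicit Types (m : cmonom I) (p q : {malg R[cmonom I]}).

Definition kweight m : nat := (\sum_(i <- finsupp m) m i * B ^ choice.pickle i)%N.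

Lemma kweightEw (d : {fset I}) m : (finsupp m `<=` d)%fset ->
  kweight m = (\sum_(i <- d) m i * B ^ choice.pickle i)%N.
Proof.
move=> le; rewrite /kweight (big_fset_incl _ le) // => i _.
by rewrite -cmE_neq0 negbK => /eqP ->.
Qed.

Lemma kweightM m1 m2 : kweight (mmul m1 m2) = (kweight m1 + kweight m2)%N.
Proof.
rewrite (kweightEw (fsubset_refl _)) mdomD.
rewrite (kweightEw (fsubsetUl (finsupp m1) (finsupp m2))).
rewrite (kweightEw (fsubsetUr (finsupp m1) (finsupp m2))).
by rewrite -big_split; apply: eq_bigr => i _; rewrite cmM mulnDl.
Qed.

Lemma kweight1 : kweight mone = 0%N.
Proof. by rewrite /kweight mdom1 big_seq_fset0. Qed.

Lemma base_digits_inj n (f g : nat -> nat) :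
    (forall j, f j < B)%N -> (forall j, g j < B)%N ->
  (\sum_(j < n) f j * B ^ j = \sum_(j < n) g j * B ^ j)%N ->
  forall j, (j < n)%N -> f j = g j.
Proof.
elim: n f g => [//|n IHn] f g ltf ltg.
have B0 : (0 < B)%N by apply: leq_ltn_trans (ltf 0%N).
have rec (h : nat -> nat) : (\sum_(j < n.+1) h j * B ^ j =
    (\sum_(j < n) h j.+1 * B ^ j) * B + h 0)%N.
  rewrite big_ord_recl expn0 muln1 addnC; congr addn.
  rewrite big_distrl; apply: eq_bigr => j _ /=.
  by rewrite -mulnA -expnSr.
rewrite !rec => eqS.
have eq0 : f 0%N = g 0%N.
  by have := congr1 (modn^~ B) eqS; rewrite !modnMDl !modn_small.
move: eqS; rewrite eq0 => /addIn /eqP; rewrite eqn_pmul2r // => /eqP eqS.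
by case=> [//|j]; rewrite ltnS; apply: (IHn (f \o succn) (g \o succn)) => //= k.
Qed.

Lemma kweight_inj m1 m2 : (forall i, m1 i < B)%N -> (forall i, m2 i < B)%N ->
  kweight m1 = kweight m2 -> m1 = m2.
Proof.
move=> lt1 lt2; pose d := (finsupp m1 `|` finsupp m2)%fset.
rewrite (kweightEw (fsubsetUl _ _ : finsupp m1 `<=` d)%fset).
rewrite (kweightEw (fsubsetUr _ _ : finsupp m2 `<=` d)%fset) => eqw.
have B0 i : (i \in d) -> (0 < B)%N by move=> _; apply: leq_ltn_trans (lt1 i).
pose dig m j := if (choice.unpickle j : option I) is Some i then
  if (choice.pickle i == j) then m i else 0%N else 0%N.
have digE m i : dig m (choice.pickle i) = m i by rewrite /dig choice.pickleK eqxx.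
pose n := (\max_(i <- d) (choice.pickle i).+1)%N.
have ltn i : i \in d -> (choice.pickle i < n)%N.
  by move=> id; rewrite /n (big_fsetD1 i) //= leq_maxl.
have sumE m : (finsupp m `<=` d)%fset ->
  (\sum_(i <- d) m i * B ^ choice.pickle i = \sum_(j < n) dig m j * B ^ j)%N.
  move=> le.
  rewrite -(big_mkord xpredT (fun j => dig m j * B ^ j)%N).
  pose s := [seq choice.pickle i | i <- d].
  rewrite (_ : (\sum_(i <- d) _ = \sum_(j <- s) dig m j * B ^ j)%N); last first.
    by rewrite big_map; apply: eq_bigr => i _; rewrite digE.
  rewrite [RHS](bigID (mem s)) /= [X in (_ = _ + X)%N]big1 ?addn0; last first.
    move=> j; rewrite /dig; case: choice.unpickle => // i js.
    case: eqP js => // <-; rewrite mem_map; last exact: pcan_inj choice.pickleK.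
    move=> id; suff /eqP -> : m i == 0%N by [].
    by rewrite cmE_eq0; apply: contra id; apply: (fsubsetP le).
  rewrite -[RHS]big_filter; apply: perm_big; apply: uniq_perm.
  - by rewrite map_inj_uniq ?fset_uniq //; apply: pcan_inj choice.pickleK.
  - by rewrite filter_uniq // iota_uniq.
  move=> j; rewrite mem_filter; case js: (j \in s) => //=.
  case/mapP: js => i id ->; rewrite mem_index_iota /=.
  by rewrite ltn.
move: eqw; rewrite !sumE ?fsubsetUl ?fsubsetUr // => eqw.
apply/eqP/cmP => i; rewrite -2!digE.
have [id|nid] := boolP (i \in d).
  apply: base_digits_inj (ltn i id); last exact: eqw.
  - by move=> j; rewrite /dig; case: choice.unpickle => [k|]; rewrite ?(B0 i) //;
       case: eqP => // _; rewrite ?(B0 i).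
  - by move=> j; rewrite /dig; case: choice.unpickle => [k|]; rewrite ?(B0 i) //;
       case: eqP => // _; rewrite ?(B0 i).
move: nid; rewrite !digE in_fsetU negb_or => /andP[].
by rewrite -!cmE_eq0 => /eqP -> /eqP ->.
Qed.

Definition kmonom m : {poly R} := 'X^(kweight m).

Lemma kmonom_mmorphism : mmorphism kmonom.
Proof.
split=> [m1 m2|]; first by rewrite /kmonom kweightM exprD.
by rewrite /kmonom kweight1.
Qed.

HB.instance Definition _ :=
  isMultiplicative.Build (cmonom I) {poly R} kmonom kmonom_mmorphism.

Definition kron p : {poly R} := mmap (@polyC R) kmonom p.

Lemma kron0 : kron 0 = 0. Proof. exact: mmap0. Qed.

Lemma kronM p q : kron (p * q) = kron p * kron q.
Proof. exact: (mmap_is_multiplicative (f := @polyC R) (h := kmonom)).1. Qed.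

Lemma kron1 : kron 1 = 1.
Proof. exact: (mmap_is_multiplicative (f := @polyC R) (h := kmonom)).2. Qed.

Lemma coef_kron p m : (forall k i, k \in msupp p -> k i < B)%N ->
  m \in msupp p -> (kron p)`_(kweight m) = p@_m.
Proof.
move=> ltB mp; rewrite /kron mmapE coef_sum (big_fsetD1 m) //=.
rewrite coefCM coefXn eqxx mulr1 big1_fset ?addr0 // => k.
rewrite in_fsetD1 => /andP[neqk kp] _; rewrite coefCM coefXn.
case: eqP => [/kweight_inj eqk|_]; last by rewrite mulr0.
by rewrite eqk ?eqxx // in neqk => i; apply: ltB.
Qed.

End Kronecker.

Section MonalgIdomain.
Context (I : countType) (R : idomainType).

Implicit Types (p q : {malg R[cmonom I]}).

Definition kbound p : nat :=
  (\max_(k <- msupp p) \max_(i <- finsupp k) (k i)).+1.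

Lemma kboundP p (k : cmonom I) (i : I) : k \in msupp p -> (k i < kbound p)%N.
Proof.
move=> kp; rewrite /kbound ltnS (big_fsetD1 k) //= leq_max; apply/orP; left.
have [ik|] := boolP (i \in finsupp k); first by rewrite (big_fsetD1 i) //= leq_maxl.
by rewrite -cmE_eq0 => /eqP ->.
Qed.

Lemma kron_eq0 B p : (kbound p <= B)%N -> kron B p = 0 -> p = 0.
Proof.
move=> leB kp0; apply/malgP => k; rewrite mcoeff0.
have [kp|/mcoeff_outdom //] := boolP (k \in msupp p).
rewrite -(coef_kron (B := B)) ?kp0 ?coef0 // => k' i /kboundP lt.
exact: leq_trans leB.
Qed.

Lemma monalg_idomain_axiom p q : p * q = 0 -> (p == 0) || (q == 0).
Proof.
move=> pq0; pose B := maxn (kbound p) (kbound q).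
have /eqP := kronM B p q; rewrite pq0 kron0 eq_sym mulf_eq0.
by case/orP=> /eqP /kron_eq0 ->; rewrite ?eqxx ?orbT ?leq_maxl ?leq_maxr.
Qed.

Definition monalg_unit : pred {malg R[cmonom I]} :=
  fun p => (p == (p@_mone)%:MP) && (p@_mone \is a GRing.unit).

Definition monalg_inv p : {malg R[cmonom I]} :=
  if monalg_unit p then ((p@_mone)^-1)%:MP else p.

Lemma monalg_mulVr : {in monalg_unit, left_inverse 1 monalg_inv *%R}.
Proof.
move=> p; rewrite -topredE /= => up.
have invE : monalg_inv p = ((p@_mone)^-1)%:MP by rewrite /monalg_inv up.
case/andP: up => /eqP pE uc.
rewrite invE; move: (p@_mone) pE uc {invE} => c -> uc.
by rewrite -mpolyCM mulVr // mpolyC1E.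
Qed.

Lemma monalg_unitP p q : q * p = 1 -> monalg_unit p.
Proof.
move=> qp1; pose B := kbound p.
have up : kron B p \is a GRing.unit.
  by apply/unitrP; exists (kron B q); rewrite [X in _ /\ X = _]mulrC -kronM qp1 kron1.
have pE : p = (p@_mone)%:MP.
  apply/malgP => k; rewrite mcoeffC.
  have [->|k1] := eqVneq k mone; first by rewrite ?eqxx.
  rewrite ?[mone == k]eq_sym ?(negbTE k1) ?mulr0n.
  apply/eqP; rewrite mcoeff_eq0; apply/negP => kp.
  have /eqP := coef_kron (B := B) (@kboundP p) kp.
  move: up; rewrite poly_unitE => /andP[/eqP sz _].
  rewrite nth_default ?sz; first by rewrite eq_sym mcoeff_eq0 kp.
  rewrite lt0n; apply: contra k1 => /eqP wk0; apply/eqP.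
  apply: (@kweight_inj _ B); rewrite ?wk0 ?kweight1 // => i; last by rewrite cm1.
  exact: kboundP.
apply/andP; split; first exact/eqP.
apply/unitrP; exists (q@_mone).
have /(congr1 (mcoeff mone)) := qp1.
by rewrite rmorphM rmorph1 [X in _ -> _ /\ X = _]mulrC => ->.
Qed.

Lemma monalg_invr_out : {in [predC monalg_unit], monalg_inv =1 id}.
Proof.
by move=> p; rewrite inE -topredE /= /monalg_inv => /negbTE ->.
Qed.

HB.instance Definition _ := GRing.ComNzRing_hasMulInverse.Build
  (malg (cmonom I) R) monalg_mulVr monalg_unitP monalg_invr_out.

HB.instance Definition _ := GRing.ComUnitRing_isIntegral.Build
  (malg (cmonom I) R) monalg_idomain_axiom.

End MonalgIdomain.

(* The indeterminates y, z, x_0, x_1, x_2, ... (x_0 never occurs below).      *)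
Inductive indet := Iy | Iz | Ix of nat.

Definition indet_code (v : indet) : bool + nat :=
  match v with Iy => inl true | Iz => inl false | Ix i => inr i end.

Definition indet_decode (c : bool + nat) : indet :=
  match c with inl true => Iy | inl false => Iz | inr i => Ix i end.

Lemma indet_codeK : cancel indet_code indet_decode.
Proof. by case. Qed.

HB.instance Definition _ := Countable.copy indet (can_type indet_codeK).

(* Z[y, z, x_1, x_2, ...] *)
Definition Upoly : idomainType := {malg int[{cmonom indet}]}.

Definition indeterminate (v : indet) : Upoly := << ucm v >>.
Definition var_y : Upoly := indeterminate Iy.
Definition var_z : Upoly := indeterminate Iz.
Definition var_x (i : nat) : Upoly := indeterminate (Ix i).

(* Finite undirected multigraphs: an edge with a single end is a loop, and    *)
(* distinct edges may have the same ends.                                     *)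
Record multigraph := Multigraph {
  vertex : finType;
  edge : finType;
  ends : edge -> {set vertex};
  ends_card : forall e, (0 < #|ends e| <= 2)%N
}.

Record rooted_graph := RootedGraph {
  underlying :> multigraph;
  graph_root : vertex underlying
}.

Section Joining.
Context (G H : rooted_graph).

Definition is_root (a : vertex G + vertex H) : bool :=
  match a with inl v => v == graph_root G | inr w => w == graph_root H end.

Definition glue : rel (vertex G + vertex H) :=
  fun a b => (a == b) || (is_root a && is_root b).

Lemma glue_equiv : equiv_class_of glue.
Proof.
split=> [a|a b|b a c]; first by rewrite /glue eqxx.
  by rewrite /glue eq_sym andbC.
rewrite /glue; case/predU1P=> [->|/andP[ra rb]] //.
by case/predU1P=> [<-|/andP[_ rc]]; rewrite ra ?rb ?rc orbT.
Qed.

Canonical glue_rel := EquivRelPack glue_equiv.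

Definition join_vertex : finType := quot_type {eq_quot glue_rel}.

Definition join_proj (a : vertex G + vertex H) : join_vertex :=
  \pi_({eq_quot glue_rel}) a.

Definition join_ends (e : edge G + edge H) : {set join_vertex} :=
  match e with
  | inl e => [set join_proj (inl v) | v in ends e]
  | inr e => [set join_proj (inr w) | w in ends e]
  end.

Lemma join_ends_card e : (0 < #|join_ends e| <= 2)%N.
Proof.
case: e => e /=; have /andP[e0 e2] := ends_card e;
  rewrite (leq_trans (leq_imset_card _ _) e2) andbT;
  by move: e0; rewrite !card_gt0 imset_eq0.
Qed.

Definition joining : rooted_graph :=
  RootedGraph (underlying := Multigraph join_ends_card) (join_proj (inl (graph_root G))).

End Joining.

Section RootedU.
Context (G : rooted_graph).
Implicit Types A : {set edge G}.

Definition adjacent A : rel (vertex G) :=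
  fun u v => [exists e in A, ends e == [set u; v]].

(* The vertex sets of the connected components of G|_A. *)
Definition components A : {set {set vertex G}} :=
  equivalence_partition (connect (adjacent A)) [set: vertex G].

Definition root_component A : {set vertex G} := pblock (components A) (graph_root G).

(* The subtraction does not truncate: k(G|_A) <= |V|. *)
Definition edge_rank A : nat := (#|vertex G| - #|components A|)%N.

Definition lambda_r A : nat := #|root_component A|.

Definition lambda_minus A : seq nat :=
  sort geq [seq #|C| | C : {set vertex G} in components A :\ root_component A].

Definition x_part (l : seq nat) : Upoly := \prod_(i <- l) var_x i.

(* Nor does |A| - r(A) truncate: a spanning forest of G|_A has r(A) edges. *)
Definition Ur : Upoly :=
  \sum_(A : {set edge G})
    x_part (lambda_minus A) * var_z ^+ lambda_r A *
      (var_y - 1) ^+ (#|A| - edge_rank A).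

End RootedU.

(* Main.v *)
Require Import Defs.
From mathcomp Require Import all_boot all_algebra fraction.
From mathcomp Require Import generic_quotient.
From mathcomp.multinomials Require Import monalg.

(** The edge sets of the joining are the disjoint unions of an edge set [B] of
    [G] and an edge set [C] of [H], so it suffices to compare, for each such
    pair, the term of the joining with the product of the terms of [B] and [C].

    Each factor is a retract of the joining: collapsing the other factor onto
    the root turns a path into a walk that may pause.  Hence two vertices of the
    joining are linked exactly when both of their collapses are
    ([linked_joining]).  It follows that a component avoiding the root is a
    component of one factor avoiding its root ([nonroot_components_joining]),
    whereas the two root components merge and share exactly the root
    ([root_component_joining]).  So the monomials in the [x_i] multiply, the
    exponent of [z] is one less than the sum of the two exponents, which accounts
    for the factor [1 / z], and since the numbers of vertices and of components
    are both one less than the sums, the ranks add ([edge_rank_joining]).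

    The exponent of [y - 1] is a difference of natural numbers.  For it to be
    additive, the rank of an edge set must not exceed its size
    ([edge_rank_le]); this holds because adding an edge merges at most two
    components ([card_components_setU1]). *)

Set Implicit Arguments.
Unset Strict Implicit.
Unset Printing Implicit Defensive.

Import GRing.Theory.
Local Open Scope ring_scope.

(** * Preliminaries *)

Lemma connect_homo (T T' : finType) (e : rel T) (e' : rel T') (f : T -> T') :
  (forall x y, e x y -> connect e' (f x) (f y)) ->
  forall x y, connect e x y -> connect e' (f x) (f y).
Proof.
move=> ef x y /connectP[p ep ->] {y}.
elim: p x ep => [|y p IHp] x /=; first by rewrite connect0.
by case/andP=> /ef exy /IHp; apply: connect_trans.
Qed.

Lemma mul_rooted_terms (R : comPzSemiRingType) (z p q s t : R) (n k l : nat) :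
    n.+1 = (k + l)%N ->
  z * (p * q * z ^+ n * (s * t)) = p * z ^+ k * s * (q * z ^+ l * t).
Proof.
move=> nkl; rewrite [RHS]mulrACA [p * _ * (q * _)]mulrACA -exprD -nkl exprS.
by rewrite !mulrA [z * p]mulrC -[p * z * q]mulrA [z * q]mulrC !mulrA.
Qed.

Lemma tofrac_eq_div (R : idomainType) (z p q r : R) :
  z != 0 -> z * p = q * r ->
  tofrac p = 1 / tofrac z * tofrac q * tofrac r :> {fraction R}.
Proof.
by move=> nz_z zp; rewrite -mulrA -tofracM -zp tofracM mul1r mulKf ?tofrac_eq0.
Qed.

Lemma imset_cancel_pair (T T' : finType) (f : T -> T') g (B : {set T}) x y :
  cancel f g -> f @: B = [set x; y] -> B = [set g x; g y].
Proof.
move=> fK /(congr1 (fun C : {set T'} => g @: C)).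
rewrite imsetU1 imset_set1 -imset_comp => <-.
by rewrite (eq_imset (g := id)) ?imset_id.
Qed.

(** * Components of spanning subgraphs *)

Section Components.
Context (G : rooted_graph).
Implicit Types (A : {set edge G}) (u v w : vertex G) (C : {set vertex G}).

Definition linked A : rel (vertex G) := connect (adjacent A).

Definition component A u : {set vertex G} := [set v | linked A u v].

Lemma adjacent_sym A : symmetric (adjacent A).
Proof. by move=> u v; apply: eq_existsb => e; rewrite setUC. Qed.

Lemma linked_refl A : reflexive (linked A).
Proof. by move=> u; apply: connect0. Qed.

Lemma linked_sym A : symmetric (linked A).
Proof. exact/sym_connect_sym/adjacent_sym. Qed.

Lemma linked_trans A : transitive (linked A).
Proof. by move=> v u w; apply: connect_trans. Qed.

Lemma linked_eqr A u v w : linked A u v -> linked A w u = linked A w v.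
Proof.
move=> uv; apply/idP/idP => [/linked_trans|]; first exact.
by move/linked_trans; apply; rewrite linked_sym.
Qed.

Lemma linked_equiv A : {in [set: vertex G] & &, equivalence_rel (linked A)}.
Proof.
move=> u v w _ _ _; split=> [|uv]; first exact: linked_refl.
by rewrite !(linked_sym A _ w) (linked_eqr _ uv).
Qed.

Lemma eq_component A u v : (component A u == component A v) = linked A u v.
Proof.
apply/eqP/idP => [/setP/(_ v)|uv]; first by rewrite !inE linked_refl.
by apply/setP => w; rewrite !inE !(linked_sym A _ w) (linked_eqr _ uv).
Qed.

Lemma componentsE A : components A = [set component A u | u : vertex G].
Proof.
apply/setP => C; apply/imsetP/imsetP => -[u _ ->]; exists u => //;
  by apply/setP => v; rewrite !inE.
Qed.

Lemma root_componentE A : root_component A = component A (graph_root G).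
Proof.
by apply/setP => v; rewrite inE (pblock_equivalence_partition (linked_equiv A)).
Qed.

Lemma nonroot_componentP A C :
  reflect (exists2 u, ~~ linked A (graph_root G) u & C = component A u)
          (C \in components A :\ root_component A).
Proof.
rewrite root_componentE componentsE; apply: (iffP setD1P).
  by case=> neC /imsetP[u _ defC]; exists u; rewrite // -eq_component eq_sym -defC.
by case=> u nu ->; rewrite eq_sym eq_component; split=> //; apply: imset_f.
Qed.

Lemma card_components A :
  #|components A| = #|components A :\ root_component A|.+1.
Proof.
rewrite (cardsD1 (root_component A)) root_componentE componentsE.
by rewrite imset_f.
Qed.

Lemma leq_card_components A : (#|components A| <= #|vertex G|)%N.
Proof. by rewrite componentsE leq_imset_card. Qed.

Lemma components0 : #|components (set0 : {set edge G})| = #|vertex G|.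
Proof.
rewrite componentsE card_imset ?cardsT // => u v /eqP; rewrite eq_component.
move=> uv; apply/eqP; rewrite eq_sym -[_ == _]/(v \in pred1 u).
rewrite -(closed_connect (e := adjacent set0) _ uv) ?inE // => x y.
by case/existsP=> e; rewrite inE.
Qed.

Lemma ends_pair (e : edge G) : exists u v, ends e = [set u; v].
Proof.
have /andP[gt0] := ends_card e; rewrite leq_eqVlt => /predU1P[/eqP/cards2P|lt2].
  by case=> u [v [_ ->]]; exists u, v.
have /cards1P[u ->] : #|ends e| == 1 by rewrite eqn_leq -ltnS lt2.
by exists u, u; rewrite setUid.
Qed.

(** A path that needs the new edge [e] passes from the component of [u] to that
    of [v] or back, so that a new link has an end in the component of [u]. *)
Lemma linked_setU1 A e u v x y : ends e = [set u; v] ->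
  ~~ linked A u x -> ~~ linked A u y -> linked (e |: A) x y -> linked A x y.
Proof.
(* [S] is the component of [x], extended by that of [u] when [x] is linked to
   [v]; it is closed under the new edge, and [y] can only lie in its first
   part. *)
move=> defe nux nuy xy.
pose S := [pred w | linked A x w || linked A u w && linked A v x].
suff clS : closed (adjacent (e |: A)) S.
  by have := closed_connect clS xy; rewrite !inE linked_refl (negbTE nuy) orbF => <-.
have uv_S : (u \in S) = (v \in S).
  rewrite !inE linked_refl linked_sym (negbTE nux) /= linked_sym.
  by case: (linked A x v); rewrite ?andbF.
have adj_S a b : adjacent A a b -> (a \in S) = (b \in S).
  by move=> /connect1 ab; rewrite !inE !(linked_eqr _ ab).
move=> a b /existsP[f /andP[/setU1P[->|fA] /eqP deff]]; last first.
  by apply: adj_S; apply/existsP; exists f; rewrite fA deff eqxx.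
rewrite defe in deff.
have aS : a \in [set u; v] by rewrite deff set21.
have bS : b \in [set u; v] by rewrite deff set22.
by case/set2P: aS bS => -> /set2P[] ->.
Qed.

(** Let [u] be an end of [e].  Every component of [A] other than that of [u] is
    what remains of a component of [e |: A] once the component of [u] in [A] is
    taken out. *)
Lemma card_components_setU1 A e :
  (#|components A| <= #|components (e |: A)|.+1)%N.
Proof.
have [u [v defe]] := ends_pair e.
have sub : components A \subset
    component A u |: [set C :\: component A u | C in components (e |: A)].
  apply/subsetP => _ /[!componentsE] /imsetP[x _ ->].
  have [ux|nux] := boolP (linked A u x).
    by rewrite inE; apply/orP; left; rewrite inE eq_sym eq_component.
  apply/setU1P; right; apply/imsetP; exists (component (e |: A) x).
    exact: imset_f.
  apply/setP => y; rewrite !inE; apply/idP/andP => [xy|[nuy]].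
    split; first by apply: contra nux => uy; apply: linked_trans uy _; rewrite linked_sym.
    apply: connect_sub xy => a b /existsP[f /andP[fA deff]]; apply: connect1.
    by apply/existsP; exists f; rewrite inE fA orbT.
  exact: linked_setU1 defe nux nuy.
apply: leq_trans (subset_leq_card sub) _; rewrite cardsU1 -add1n leq_add ?leq_b1 //.
exact: leq_imset_card.
Qed.

Lemma card_vertex_le A : (#|vertex G| <= #|A| + #|components A|)%N.
Proof.
move: {2}#|A| (erefl #|A|) => n; elim: n A => [|n IHn] A.
  by move/eqP; rewrite cards_eq0 => /eqP ->; rewrite components0 leq_addl.
move=> cA; have /card_gt0P[e eA] : (0 < #|A|)%N by rewrite cA.
have := cardsD1 e A; rewrite eA cA add1n => -[/esym cA'].
apply: leq_trans (IHn _ cA') _; rewrite cA' addSnnS leq_add2l.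
by rewrite -{2}(setD1K eA) card_components_setU1.
Qed.

Lemma edge_rank_le A : (edge_rank A <= #|A|)%N.
Proof. by rewrite leq_subLR addnC card_vertex_le. Qed.

Lemma x_partE A :
  x_part (lambda_minus A) =
    \prod_(C in components A :\ root_component A) var_x #|C|.
Proof. by rewrite /x_part (perm_big _ (permEl (perm_sort _ _))) big_image. Qed.

Definition Ur_term A : Upoly :=
  x_part (lambda_minus A) * var_z ^+ lambda_r A *
    (var_y - 1) ^+ (#|A| - edge_rank A).

End Components.

(** * Components of a joining *)

Section JoiningComponents.
Context (G H : rooted_graph).

Local Notation J := (joining G H).

Implicit Types (u v : vertex G) (w : vertex H) (a b : vertex J).

Definition embedl u : vertex J := join_proj (inl u).
Definition embedr w : vertex J := join_proj (inr w).

(** The retractions collapse one factor onto the root.  The choice of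
    representative is harmless, as only the root has more than one. *)
Definition retractl a : vertex G :=
  if repr a is inl u then u else graph_root G.
Definition retractr a : vertex H :=
  if repr a is inr w then w else graph_root H.

Lemma embed_root : embedl (graph_root G) = embedr (graph_root H).
Proof. by apply/eqmodP; rewrite /= /glue /= !eqxx. Qed.

Lemma repr_join_proj (c : vertex G + vertex H) : glue (repr (join_proj c)) c.
Proof. by apply/(eqmodP (glue_rel G H)); rewrite reprK. Qed.

Lemma embedlK : cancel embedl retractl.
Proof.
move=> u; rewrite /retractl.
by case/predU1P: (repr_join_proj (inl u)) => [-> //|];
  case: (repr _) => c /andP[/= /eqP rc /eqP ->].
Qed.

Lemma embedrK : cancel embedr retractr.
Proof.
move=> w; rewrite /retractr.
by case/predU1P: (repr_join_proj (inr w)) => [-> //|];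
  case: (repr _) => c /andP[/= /eqP rc /eqP ->].
Qed.

Lemma retractl_embedr w : retractl (embedr w) = graph_root G.
Proof.
rewrite /retractl; case/predU1P: (repr_join_proj (inr w)) => [-> //|].
by case: (repr _) => c /andP[/= /eqP rc _].
Qed.

Lemma retractr_embedl u : retractr (embedl u) = graph_root H.
Proof.
rewrite /retractr; case/predU1P: (repr_join_proj (inl u)) => [-> //|].
by case: (repr _) => c /andP[/= /eqP rc _].
Qed.

Lemma embedl_inj : injective embedl. Proof. exact: can_inj embedlK. Qed.
Lemma embedr_inj : injective embedr. Proof. exact: can_inj embedrK. Qed.

Variant join_vertex_spec : vertex J -> Prop :=
  | JoinVertexl u : join_vertex_spec (embedl u)
  | JoinVertexr w : join_vertex_spec (embedr w).

Lemma join_vertexP a : join_vertex_spec a.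
Proof. by rewrite -[a]reprK; case: (repr a) => c; constructor. Qed.

Lemma mem_embedl (B : {set vertex G}) u : (embedl u \in embedl @: B) = (u \in B).
Proof. exact: mem_imset embedl_inj. Qed.
Lemma mem_embedr (B : {set vertex H}) w : (embedr w \in embedr @: B) = (w \in B).
Proof. exact: mem_imset embedr_inj. Qed.

Lemma mem_embedlr (B : {set vertex H}) u :
  (embedl u \in embedr @: B) = (u == graph_root G) && (graph_root H \in B).
Proof.
apply/imsetP/andP => [[w wB eq_uw]|[/eqP -> rB]].
  rewrite -(embedlK u) eq_uw retractl_embedr eqxx.
  by rewrite -(retractr_embedl u) eq_uw embedrK.
by exists (graph_root H); rewrite // embed_root.
Qed.

Lemma mem_embedrl (B : {set vertex G}) w :
  (embedr w \in embedl @: B) = (w == graph_root H) && (graph_root G \in B).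
Proof.
apply/imsetP/andP => [[u uB eq_wu]|[/eqP -> rB]].
  rewrite -(embedrK w) eq_wu retractr_embedl eqxx.
  by rewrite -(retractl_embedr w) eq_wu embedlK.
by exists (graph_root G); rewrite // embed_root.
Qed.

(** The root is the one vertex counted twice. *)
Lemma card_embedU (B : {set vertex G}) (C : {set vertex H}) :
    graph_root G \in B -> graph_root H \in C ->
  (#|embedl @: B :|: embedr @: C|.+1 = #|B| + #|C|)%N.
Proof.
move=> rB rC; rewrite -(card_imset B embedl_inj) -(card_imset C embedr_inj) -cardsUI.
suff -> : embedl @: B :&: embedr @: C = [set embedl (graph_root G)].
  by rewrite cards1 addn1.
apply/setP => a; rewrite !inE; apply/andP/eqP => [[/imsetP[u _ ->]]|->].
  by rewrite mem_embedlr => /andP[/eqP ->].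
by rewrite mem_embedl mem_embedlr eqxx.
Qed.

Lemma card_vertex_joining : (#|vertex J|.+1 = #|vertex G| + #|vertex H|)%N.
Proof.
rewrite -[#|vertex J|]cardsT -[#|vertex G|]cardsT -[#|vertex H|]cardsT.
rewrite -card_embedU //; congr _.+1; apply: eq_card => a; rewrite !inE.
case/join_vertexP: a => x.
  by rewrite mem_embedl inE.
by rewrite orbC mem_embedr inE.
Qed.

Section Edges.
Context (A : {set edge J}).

Definition edgesl : {set edge G} := inl @^-1: A.
Definition edgesr : {set edge H} := inr @^-1: A.

Lemma linked_embedl u v : linked edgesl u v -> linked A (embedl u) (embedl v).
Proof.
apply: connect_homo u v => u v /existsP[e /andP[eA /eqP defe]].
apply/connect1/existsP; exists (inl e); rewrite inE in eA.
by rewrite eA /= defe imsetU1 imset_set1.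
Qed.

Lemma linked_embedr w w' : linked edgesr w w' -> linked A (embedr w) (embedr w').
Proof.
apply: connect_homo w w' => w w' /existsP[e /andP[eA /eqP defe]].
apply/connect1/existsP; exists (inr e); rewrite inE in eA.
by rewrite eA /= defe imsetU1 imset_set1.
Qed.

Lemma linked_retractl a b : linked A a b -> linked edgesl (retractl a) (retractl b).
Proof.
apply: connect_homo a b => a b /existsP[[e|e] /andP[eA /eqP /= defe]].
  apply/connect1/existsP; exists e; rewrite inE eA; apply/eqP.
  exact: imset_cancel_pair embedlK defe.
have /imsetP[u _ ->] : a \in embedr @: ends e by rewrite defe set21.
have /imsetP[v _ ->] : b \in embedr @: ends e by rewrite defe set22.
by rewrite !retractl_embedr connect0.
Qed.

Lemma linked_retractr a b : linked A a b -> linked edgesr (retractr a) (retractr b).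
Proof.
apply: connect_homo a b => a b /existsP[[e|e] /andP[eA /eqP /= defe]].
  have /imsetP[u _ ->] : a \in embedl @: ends e by rewrite defe set21.
  have /imsetP[v _ ->] : b \in embedl @: ends e by rewrite defe set22.
  by rewrite !retractr_embedl connect0.
apply/connect1/existsP; exists e; rewrite inE eA; apply/eqP.
exact: imset_cancel_pair embedrK defe.
Qed.

(** Conversely to the retractions, a vertex of [G] and a vertex of [H] that are
    each linked to their root are linked through the common root. *)
Lemma linked_joining a b :
  linked A a b = linked edgesl (retractl a) (retractl b) &&
                 linked edgesr (retractr a) (retractr b).
Proof.
apply/idP/andP => [ab|[]]; first by rewrite linked_retractl ?linked_retractr.
case/join_vertexP: a => x; case/join_vertexP: b => y;
  rewrite ?embedlK ?embedrK ?retractl_embedr ?retractr_embedl => xyl xyr.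
- exact: linked_embedl.
- by apply: linked_trans (linked_embedl xyl) _; rewrite embed_root linked_embedr.
- by apply: linked_trans (linked_embedr xyr) _; rewrite -embed_root linked_embedl.
- exact: linked_embedr.
Qed.

Lemma root_component_joining :
  root_component A = embedl @: root_component edgesl :|: embedr @: root_component edgesr.
Proof.
apply/setP => a; rewrite !root_componentE !inE linked_joining embedlK retractr_embedl.
case/join_vertexP: a => x; rewrite ?embedlK ?embedrK ?retractl_embedr ?retractr_embedl.
  rewrite mem_embedl mem_embedlr !inE !linked_refl !andbT.
  by case: eqP => [->|]; rewrite ?linked_refl ?orbF.
rewrite mem_embedr mem_embedrl !inE !linked_refl !andbT.
by case: eqP => [->|]; rewrite ?linked_refl ?orbF.
Qed.

(** A vertex of [G] reaches [H] only through the root. *)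
Lemma component_embedl u : ~~ linked edgesl (graph_root G) u ->
  component A (embedl u) = embedl @: component edgesl u.
Proof.
move=> nru; apply/setP => a; rewrite inE linked_joining embedlK retractr_embedl.
case/join_vertexP: a => x; rewrite ?mem_embedl ?mem_embedrl ?inE.
  by rewrite embedlK retractr_embedl linked_refl andbT.
by rewrite retractl_embedr linked_sym (negbTE nru) andbF.
Qed.

Lemma component_embedr w : ~~ linked edgesr (graph_root H) w ->
  component A (embedr w) = embedr @: component edgesr w.
Proof.
move=> nrw; apply/setP => a; rewrite inE linked_joining embedrK retractl_embedr.
case/join_vertexP: a => x; rewrite ?mem_embedr ?mem_embedlr ?inE.
  by rewrite retractr_embedl !(linked_sym _ _ (graph_root H)) (negbTE nrw) !andbF.
by rewrite embedrK retractl_embedr linked_refl.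
Qed.

Lemma nonroot_components_joining :
  components A :\ root_component A =
    [set embedl @: (C : {set vertex G})
      | C in components edgesl :\ root_component edgesl] :|:
    [set embedr @: (C : {set vertex H})
      | C in components edgesr :\ root_component edgesr].
Proof.
have rootl u : linked A (graph_root J) (embedl u) = linked edgesl (graph_root G) u.
  by rewrite linked_joining !embedlK !retractr_embedl linked_refl andbT.
have rootr w : linked A (graph_root J) (embedr w) = linked edgesr (graph_root H) w.
  by rewrite linked_joining embedlK embedrK retractr_embedl retractl_embedr linked_refl.
apply/setP => C; apply/nonroot_componentP/setUP => [[a nra ->]|].
  case/join_vertexP: a nra => x; rewrite ?rootl ?rootr => nrx; [left|right]; apply/imsetP.
    exists (component edgesl x); last exact: component_embedl.
    by apply/nonroot_componentP; exists x.
  exists (component edgesr x); last exact: component_embedr.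
  by apply/nonroot_componentP; exists x.
case=> /imsetP[_ /nonroot_componentP[x nrx ->] ->].
  by exists (embedl x); rewrite ?rootl ?component_embedl.
by exists (embedr x); rewrite ?rootr ?component_embedr.
Qed.

(** The two copies meet in the root only, and components are nonempty. *)
Lemma disjoint_nonroot_components :
  [disjoint [set embedl @: (C : {set vertex G})
      | C in components edgesl :\ root_component edgesl]
          & [set embedr @: (C : {set vertex H})
      | C in components edgesr :\ root_component edgesr]].
Proof.
apply/pred0P => C /=; apply/negP => /andP[/imsetP[_ /nonroot_componentP[u nru ->] ->]].
case/imsetP=> _ /nonroot_componentP[w _ ->] /setP/(_ (embedl u)).
rewrite mem_embedl mem_embedlr !inE linked_refl => /esym/andP[/eqP eq_u _].
by rewrite eq_u linked_refl in nru.
Qed.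

Lemma prod_nonroot_components_joining (R : comPzSemiRingType) (f : nat -> R) :
  \prod_(C in components A :\ root_component A) f #|C| =
    (\prod_(C in components edgesl :\ root_component edgesl) f #|C|) *
    \prod_(C in components edgesr :\ root_component edgesr) f #|C|.
Proof.
rewrite nonroot_components_joining (eq_bigl _ _ (fun C => in_setU C _ _)).
rewrite bigU ?disjoint_nonroot_components //=.
rewrite !big_imset /=; last 2 first.
- by move=> B C _ _; apply: (imset_inj embedr_inj).
- by move=> B C _ _; apply: (imset_inj embedl_inj).
congr (_ * _); apply: eq_bigr => C _; rewrite card_imset //.
  exact: embedl_inj.
exact: embedr_inj.
Qed.

Lemma lambda_r_joining : (lambda_r A).+1 = (lambda_r edgesl + lambda_r edgesr)%N.
Proof.
by rewrite /lambda_r root_component_joining card_embedU // root_componentE inE linked_refl.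
Qed.

Lemma card_components_joining :
  (#|components A|.+1 = #|components edgesl| + #|components edgesr|)%N.
Proof.
rewrite !card_components nonroot_components_joining cardsU.
rewrite (disjoint_setI0 disjoint_nonroot_components) cards0 subn0.
rewrite !card_imset ?addnS ?addSn //; apply: imset_inj.
  exact: embedr_inj.
exact: embedl_inj.
Qed.

(** The truncated differences add up because an edge set has at most as many
    components as there are vertices. *)
Lemma edge_rank_joining : edge_rank A = (edge_rank edgesl + edge_rank edgesr)%N.
Proof.
rewrite /edge_rank -subSS card_components_joining card_vertex_joining.
by rewrite subnDA -addnBAC ?leq_card_components // -addnBA ?leq_card_components.
Qed.

Lemma card_edges_joining : #|A| = (#|edgesl| + #|edgesr|)%N.
Proof.
by rewrite -!sum1_card big_sumType /=; congr addn; apply: eq_bigl => e; rewrite inE.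
Qed.

End Edges.

(** * The product formula *)

Lemma Ur_term_joining (A : {set edge J}) :
  var_z * Ur_term A = Ur_term (edgesl A) * Ur_term (edgesr A).
Proof.
rewrite /Ur_term !x_partE prod_nonroot_components_joining.
have -> : (#|A| - edge_rank A = #|edgesl A| - edge_rank (edgesl A) +
    (#|edgesr A| - edge_rank (edgesr A)))%N.
  rewrite card_edges_joining edge_rank_joining.
  by rewrite subnDA -addnBAC ?edge_rank_le // -addnBA ?edge_rank_le.
rewrite exprD; exact: mul_rooted_terms (lambda_r_joining A).
Qed.

Lemma sum_edges_joining (R : nmodType) (F : {set edge G} -> {set edge H} -> R) :
  \sum_(A : {set edge J}) F (edgesl A) (edgesr A) = \sum_B \sum_C F B C.
Proof.
rewrite pair_bigA (reindex (fun A : {set edge J} => (edgesl A, edgesr A))) //=.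
pose glue_edges (BC : {set edge G} * {set edge H}) : {set edge J} :=
  [set e | match e with inl e => e \in BC.1 | inr e => e \in BC.2 end].
exists glue_edges => [A|[B C]] _ /=; first by apply/setP => -[e|e]; rewrite !inE.
by congr pair; apply/setP => e; rewrite !inE.
Qed.

End JoiningComponents.

Lemma var_z_neq0 : var_z != 0.
Proof. by rewrite monalgU_eq0. Qed.

Lemma Ur_joining (G H : rooted_graph) : var_z * Ur (joining G H) = Ur G * Ur H.
Proof.
rewrite /Ur big_distrlr -sum_edges_joining big_distrr /=.
by apply: eq_bigr => A _; apply: Ur_term_joining.
Qed.

Theorem lemma4 (G H : rooted_graph) :
  tofrac (Ur (joining G H)) =
    1 / tofrac var_z * tofrac (Ur G) * tofrac (Ur H) :> {fraction Upoly}.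
Proof.
exact: tofrac_eq_div var_z_neq0 (Ur_joining G H).
Qed.
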